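(* Fix $k\ge 2$ and $a\ge 0$. There exist constants $c=c(k,a)>0$ and $C=C(k,a)>0$ such that the following holds for all sufficiently large $n$. Set $$\Delta=\left\lceil C\log^{a+2} n\right\rceil .$$ Any deterministic one-pass streaming algorithm that properly colors every $n$-vertex $k$-uniform hypergraph of maximum degree at most $\Delta$ using $O(n\log^a n)$ bits of space must use at least $\exp(\Delta^c)$ colors in the worst case.
   Context: A hypergraph $H=(V,E)$ is $k$-uniform if every edge is a set of exactly $k$ vertices. A proper coloring assigns a color to each vertex so that no edge is monochromatic. The degree of a vertex is the number of edges containing it, and the maximum degree is the maximum over all vertices. A deterministic one-pass streaming algorithm using $S$ bits has at most $2^S$ possible memory states; it starts in a fixed state, reads the edges of the input hypergraph one at a time in an arbitrary order (each edge appearing exactly once, never deleted), updating its state deterministically as a function of the current state and the arriving edge, and after the stream outputs a coloring of the vertex set determined by its final state. It is required to output a proper coloring for every valid input stream (any hypergraph in the stated class, any edge order). The number of colors used in the worst case is the maximum, over valid input streams, of the number of colors in the output coloring. The bound $O(n\log^a n)$ means $S\le C_0\, n\log^a n$ for an arbitrary fixed constant $C_0>0$; ''sufficiently large $n$'' may depend on $k,a,C_0$. Logarithms are natural. *)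

(* Defs.v *)
From mathcomp Require Import all_boot all_order all_algebra.
From mathcomp Require Import reals exp.

Set Implicit Arguments.
Unset Strict Implicit.
Unset Printing Implicit Defensive.

Import Order.TTheory GRing.Theory Num.Theory.

Section Hypergraphs.
Variable V : finType.
Implicit Types (E : {set {set V}}) (f : V -> nat).

Definition uniform (k : nat) E : bool := [forall e in E, #|e| == k].

Definition degree E (v : V) : nat := #|[set e in E | v \in e]|.

Definition max_degree E : nat := \max_(v : V) degree E v.

Definition monochromatic f (e : {set V}) : bool :=
  [forall u in e, forall v in e, f u == f v].

Definition proper_coloring E f : bool := [forall e in E, ~~ monochromatic f e].

Definition num_colors f : nat := size (undup (codom f)).

Definition valid_input (k D : nat) E : bool :=
  uniform k E && (max_degree E <= D).

(* The input streams presenting E: each edge exactly once, in any order. *)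
Definition streams E : seq (seq {set V}) := permutations (enum E).

End Hypergraphs.

(* The space usage is not part of the record: see [uses_bits].  Taking colors *)
(* in nat is no restriction, V being finite.                                  *)
Record stream_alg (V : finType) := StreamAlg {
  state : finType;
  init : state;
  update : state -> {set V} -> state;
  output : state -> V -> nat
}.

Section Streaming.
Variable V : finType.
Implicit Types (A : stream_alg V) (k D : nat).

Definition uses_bits A (S : nat) : Prop := (#|state A| <= 2 ^ S)%N.

Definition run A (s : seq {set V}) : V -> nat :=
  output (foldl (@update V A) (init A) s).

Definition properly_colors A k D : Prop :=
  forall (E : {set {set V}}) (s : seq {set V}),
    valid_input k D E -> s \in streams E -> proper_coloring E (run A s).

Definition worst_case_colors A k D : nat :=
  \max_(E : {set {set V}} | valid_input k D E)
    \max_(s <- streams E) num_colors (run A s).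

End Streaming.

Local Open Scope ring_scope.

(* The ceiling is nonnegative when 0 <= C, so the absolute value only casts   *)
(* it to nat.                                                                 *)
Definition Delta (R : realType) (C a : R) (n : nat) : nat :=
  `|Num.ceil (C * ln n%:R `^ (a + 2))|%N.

(* Main.v *)
Require Import Defs.
From mathcomp Require Import all_boot all_order all_algebra.
From mathcomp Require Import reals sequences exp.
From mathcomp Require Import zify ring lra.

(** The lower bound is an adversary argument in [t] rounds. After each round
    the adversary keeps a memory state [q], a set [U] of surviving vertices and
    a set [M] of missing k-sets inside [U], such that every other k-set inside
    [U] is an edge of some legal stream leading to [q]. All these streams end
    with the same coloring, so a k-set inside [U] that is monochromatic in the
    final coloring must be missing. Few missing sets therefore force many
    colors.

    In one round ([popular_state]) all degrees of [M] are at most [h * m]. A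
    random subset of [M] keeps each edge with probability 1/(2h); its expected
    degrees are at most m/2, and all its degrees are at most 2m with probability
    at least 1/2 because [n <= 2 ^ m] ([half_low_degree]). One of the at most
    2^S next states absorbs a 2^-(S+1) fraction of all choices. The edges of [M] that none of these
    choices uses form a set [F] that a random subset avoids with probability at
    least 2^-(S+1), while this probability is (1 - 1/(2h))^|F|; hence
    |F| < 2h(S+2). Deleting the few vertices of large degree in [F] leaves a
    missing set whose degrees are at most [h/2 * m]: each round costs 2m in the
    degree of the stream and halves the degrees of the missing set
    ([adversary]). Since all future edges come from [M], which is disjoint from
    the edges already sent, no edge is ever repeated.

    The first missing set consists of all k-sets and has degrees below
    n^(k-1), so after [t] rounds the degrees are about n^(k-1) / 2^t * m, and
    at least half of the vertices survive. A color class of [x] survivors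
    yields binomial(x-1, k-1) missing sets at each of its vertices, which is
    impossible for x >= n / 2^(r+1) when t = k(r+2) and m is small compared with
    2^r; hence 2^r colors are needed ([colors_lower_bound]).

    With D = ceil(log^(a+2) n), the choice c = 1/(4(a+2)) makes D^c comparable
    to log^(1/4) n. Then r ~ 2 D^c and m ~ D/(2t) satisfy all the constraints
    for large n ([parameters_exist]), with room to spare in the powers of log n,
    which is why the constant C = 1 serves for every space constant C0. *)

Set Implicit Arguments.
Unset Strict Implicit.
Unset Printing Implicit Defensive.

Import Order.TTheory GRing.Theory Num.Theory.

(** * Inequalities between powers of natural numbers *)

Lemma leq_expn2r (a b e : nat) : a <= b -> a ^ e <= b ^ e.
Proof. by case: e => // e; rewrite leq_exp2r. Qed.

Lemma exp0n_eq0 (d : nat) : 0 ^ d = (d == 0).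
Proof. by case: d => // d; rewrite exp0n. Qed.

(** This is (1 + 1/L)^j <= L / (L - j). *)
Lemma expnS_mul_subn_le (L j : nat) : j <= L -> L.+1 ^ j * (L - j) <= L ^ j.+1.
Proof.
elim: j => [|j IHj] jL; first by rewrite expn0 expn1; lia.
have := IHj (ltnW jL).
rewrite (expnS L.+1) (expnS L j.+1) => IH.
have step : L.+1 * (L - j.+1) <= L * (L - j) by nia.
rewrite -mulnA mulnCA.
apply: leq_trans (leq_mul (leqnn _) step) _.
by rewrite mulnCA leq_mul2l IH orbT.
Qed.

(** With L = 2h and j = h, the previous bound gives (1 + 1/(2h))^h <= 2; the
    even base avoids any appeal to the number e. *)
Lemma expnS_double_le (h m d : nat) :
  0 < h -> d <= h * m -> h.*2.+1 ^ d <= 2 ^ m * h.*2 ^ d.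
Proof.
move=> h_gt0 le_d.
have half : h.*2.+1 ^ h <= 2 * h.*2 ^ h.
  have := @expnS_mul_subn_le h.*2 h ltac:(lia).
  have -> : h.*2 - h = h by lia.
  rewrite expnS -mul2n -(leq_pmul2r h_gt0); nia.
have h2_gt0 : 0 < h.*2 ^ (h * m - d) by rewrite expn_gt0 double_gt0 h_gt0.
rewrite -(leq_pmul2r h2_gt0) -mulnA -expnD subnKC //.
apply: leq_trans (_ : h.*2.+1 ^ (h * m) <= _).
  by rewrite -{2}(subnKC le_d) expnD leq_mul2l leq_expn2r ?orbT.
by rewrite !(expnM _ h) -expnMn leq_expn2r.
Qed.

Lemma expnS_ge_bernoulli (l N : nat) : l ^ N.+1 + N.+1 * l ^ N <= l.+1 ^ N.+1.
Proof.
elim: N => [|N IHN]; first by rewrite !expn1 expn0; lia.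
rewrite (expnS l.+1) (expnS l N.+1); move: IHN; rewrite (expnS l N); nia.
Qed.

(** This is (1 - 1/(l+1))^N <= 2^-j; (l+1)^(l+1) >= 2 l^(l+1) is a case of
    Bernoulli's inequality. *)
Lemma expn2_mul_le (l j N : nat) : l.+1 * j <= N -> 2 ^ j * l ^ N <= l.+1 ^ N.
Proof.
move=> le_N; have one : 2 * l ^ l.+1 <= l.+1 ^ l.+1.
  by have := @expnS_ge_bernoulli l l; rewrite (expnS l); nia.
rewrite -(subnKC le_N) [l ^ _]expnD [l.+1 ^ _]expnD mulnA leq_mul ?leq_expn2r //.
by rewrite !(expnM _ l.+1) -expnMn leq_expn2r.
Qed.

(** * Random subsets of a finite set *)

Section Sampling.
Variables (T : finType) (l : nat).
Implicit Types (X M F : {set T}) (phi : {ffun T -> 'I_l.+1}).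

(** For a uniform [phi], each element of [M] is kept independently with
    probability 1/(l+1). *)
Definition sample M phi : {set T} := [set e in M | phi e == ord0].

(** The generating function of the binomial size of [sample X phi]. Its value
    at 0 counts the empty samples, its value at 2 bounds the large ones. *)
Lemma sample_gen_fun (w : nat) X :
  \sum_(phi : {ffun T -> 'I_l.+1}) w ^ #|sample X phi| = (l + w) ^ #|X| * l.+1 ^ #|~: X|.
Proof.
pose F (e : T) (j : 'I_l.+1) := if (e \in X) && (j == ord0) then w else 1.
have -> : \sum_(phi : {ffun T -> 'I_l.+1}) w ^ #|sample X phi| = \sum_(phi : {ffun T -> 'I_l.+1}) \prod_e F e (phi e).
  apply: eq_bigr => phi _; rewrite -prod_nat_const big_mkcond /=.
  by apply: eq_bigr => e _; rewrite /F inE.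
rewrite -bigA_distr_bigA /=.
have sumF e : \sum_j F e j = if e \in X then l + w else l.+1.
  rewrite /F big_ord_recl eqxx andbT.
  under eq_bigr do rewrite eq_sym (negbTE (neq_lift _ _)) andbF.
  rewrite sum_nat_const card_ord muln1.
  by case: (e \in X); [exact: addnC|].
under eq_bigr do rewrite sumF.
rewrite (bigID (mem X)) /= (eq_bigr (fun=> l + w)) => [|e ->] //.
rewrite [X in _ * X](eq_bigr (fun=> l.+1)) => [|e /negbTE->] //.
rewrite !prod_nat_const; congr (_ * _ ^ _).
by apply: eq_card => e; rewrite !inE.
Qed.

Lemma card_sample_set0 X :
  #|[set phi : {ffun T -> 'I_l.+1} | sample X phi == set0]| = l ^ #|X| * l.+1 ^ #|~: X|.
Proof.
rewrite -[X in X ^ _]addn0 -sample_gen_fun -sum1_card big_mkcond /=.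
by apply: eq_bigr => phi _; rewrite inE -cards_eq0 exp0n_eq0; case: eqP.
Qed.

Lemma card_sample_large X D :
  2 ^ D.+1 * #|[set phi : {ffun T -> 'I_l.+1} | D < #|sample X phi| ]| <= l.+2 ^ #|X| * l.+1 ^ #|~: X|.
Proof.
have -> : l.+2 = l + 2 by rewrite addn2.
rewrite -sample_gen_fun mulnC -sum_nat_const big_mkcond /=.
apply: leq_sum => phi _; rewrite inE; case: ifP => // D_lt.
by rewrite leq_exp2l.
Qed.

End Sampling.

(** The values are listed by a sequence because the lemma serves both for the
    states after a round, a finite type, and for the colors of the vertices,
    which are natural numbers. *)
Lemma pigeonhole (T : finType) (C : eqType) (f : T -> C) (s : seq C) (A : {set T}) :
  uniq s -> {in A, forall x, f x \in s} -> A != set0 ->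
  exists2 c, c \in s & #|A| <= size s * #|[set x in A | f x == c]|.
Proof.
move=> s_uniq fs A_neq0.
have cardA : #|A| = \sum_(c <- s) #|[set x in A | f x == c]|.
  rewrite -sum1_card (eq_bigr (fun x => \sum_(c <- s) (f x == c))); last first.
    move=> x /fs; rewrite -big_mkcond sum1_count /= => fx.
    by rewrite (eq_count (a2 := pred1 (f x))) ?count_uniq_mem ?fx // => c /=; rewrite eq_sym.
  rewrite exchange_big; apply: eq_bigr => c _ /=.
  rewrite -sum1_card [RHS]big_mkcond [LHS]big_mkcond /=; apply: eq_bigr => x _.
  by rewrite inE; case: (x \in A); case: (f x == c).
have [/hasP // | /hasPn small] :=
  boolP (has (fun c => #|A| <= size s * #|[set x in A | f x == c]|) s).
have : \sum_(c <- s) (size s * #|[set x in A | f x == c]|).+1 <= \sum_(c <- s) #|A|.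
  by rewrite big_seq [X in _ <= X]big_seq leq_sum // => c /small; rewrite -ltnNge.
rewrite big_const_seq count_predT iter_addn_0.
under eq_bigr do rewrite -addn1.
rewrite big_split -big_distrr /= -cardA sum1_size mulnC.
case: (s) fs => [fs|c0 s'] /=; last by lia.
by have [x /fs] := set0Pn _ A_neq0.
Qed.

(** * One round of the adversary *)

Section Round.
Variable V : finType.
Implicit Types (M F G : {set {set V}}).

(** By Markov's inequality for 2^deg, the degree at one vertex exceeds 2m with
    probability at most (1 + 1/(2h))^(hm) / 2^(2m+1) <= 2^-(m+1), and there are
    at most 2^m vertices. *)
Lemma half_low_degree M (h m : nat) :
  0 < h -> #|V| <= 2 ^ m -> (forall v, degree M v <= h * m) ->
  h.*2 ^ #|{set V}| <=
    2 * #|[set phi : {ffun {set V} -> 'I_(h.*2.-1).+1} |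
             [forall v, degree (sample M phi) v <= m.*2]]|.
Proof.
move=> h_gt0 V_le deg_le; have hE : (h.*2.-1).+1 = h.*2 by lia.
set l := h.*2.-1 in hE *; set good := [set phi | _].
pose M_ v := [set e in M | v \in e].
pose large v := [set phi : {ffun {set V} -> 'I_l.+1} | m.*2 < #|sample (M_ v) phi| ].
have degE v phi : degree (sample M phi) v = #|sample (M_ v) phi|.
  by rewrite /degree; apply: eq_card => e; rewrite !inE andbAC.
have large_le v : 2 ^ (m.*2.+1) * #|large v| <= 2 ^ m * h.*2 ^ #|{set V}|.
  apply: leq_trans (@card_sample_large _ l (M_ v) m.*2) _.
  rewrite -(cardsC (M_ v)) expnD mulnA hE leq_mul //.
  exact: (expnS_double_le h_gt0 (deg_le v)).
have bad_le : #|~: good| <= \sum_v #|large v|.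
  have subU : ~: good \subset \bigcup_v large v.
    apply/subsetP => phi; rewrite !inE negb_forall => /existsP[v].
    by rewrite -ltnNge degE => v_large; apply/bigcupP; exists v; rewrite ?inE.
  apply: leq_trans (subset_leq_card subU) _.
  elim/big_ind2: _ => [|A a B b leA leB|//]; first by rewrite cards0.
  exact: leq_trans (leq_card_setU _ _) (leq_add leA leB).
have bad2 : 2 * #|~: good| <= h.*2 ^ #|{set V}|.
  have pow_gt0 : 0 < 2 ^ m.*2 by rewrite expn_gt0.
  rewrite -(leq_pmul2l pow_gt0) mulnA -expnSr.
  apply: leq_trans (leq_mul (leqnn _) bad_le) _.
  rewrite big_distrr /=.
  apply: leq_trans (leq_sum (index_enum V) (fun v (_ : true) => large_le v)) _.
  by rewrite sum_nat_const mulnA leq_mul // -addnn expnD leq_mul.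
have cardOm : #|good| + #|~: good| = h.*2 ^ #|{set V}|.
  by rewrite cardsC card_ffun card_ord; congr (_ ^ _).
lia.
Qed.

(** Let [q] be a state reached by at least the average number of low-degree
    samples and [F] the set of edges of [M] that no low-degree sample leading
    to [q] uses. These samples all avoid [F], and they are too numerous for [F]
    to be large. *)
Lemma popular_state (Q : finType) (f : {set {set V}} -> Q) (S h m : nat) M :
    0 < h -> #|V| <= 2 ^ m -> #|Q| <= 2 ^ S ->
    (forall v, degree M v <= h * m) ->
  exists q F, [/\ F \subset M, #|F| < h.*2 * S.+2,
    exists G, [/\ G \subset M, [disjoint G & F], (forall v, degree G v <= m.*2) & f G = q]
    & forall e, e \in M :\: F -> exists G,
      [/\ G \subset M, [disjoint G & F], (forall v, degree G v <= m.*2), f G = q & e \in G]].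
Proof.
move=> h_gt0 V_le Q_le deg_le.
have := @half_low_degree M h m h_gt0 V_le deg_le.
have hE : (h.*2.-1).+1 = h.*2 by lia.
set l := h.*2.-1 in hE *; set good := [set phi | _] => good_ge.
have Om_gt0 : 0 < h.*2 ^ #|{set V}| by rewrite expn_gt0 double_gt0 h_gt0.
have good_neq0 : good != set0 by rewrite -card_gt0; lia.
have [q _ q_ge] := @pigeonhole _ _ (fun phi => f (sample M phi)) (enum Q) good
  (enum_uniq Q) (fun phi _ => mem_enum Q _) good_neq0.
rewrite -cardE in q_ge; set cls := [set phi in good | _] in q_ge.
have cls_ge : h.*2 ^ #|{set V}| <= 2 ^ S.+1 * #|cls|.
  rewrite expnS -mulnA (leq_trans good_ge) // leq_mul2l (leq_trans q_ge) //.
  by rewrite leq_mul2r Q_le orbT.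
have [phi0 phi0_cls] : exists phi, phi \in cls.
  by apply/set0Pn; rewrite -card_gt0; lia.
pose F := [set e in M | [forall phi in cls, e \notin sample M phi]].
have clsP phi : phi \in cls -> [/\ sample M phi \subset M, [disjoint sample M phi & F],
    (forall v, degree (sample M phi) v <= m.*2) & f (sample M phi) = q].
  move=> phi_cls; split.
  - by apply/subsetP => e; rewrite inE => /andP[].
  - rewrite disjoint_sym disjoint_subset; apply/subsetP => e.
    by rewrite inE => /andP[_ /forall_inP/(_ phi phi_cls) eN]; rewrite !inE in eN *.
  - move=> v; move: phi_cls; rewrite !inE; by case/andP=> /forallP/(_ v).
  - by move: phi_cls; rewrite !inE => /andP[_ /eqP].
exists q, F; split.
- by apply/subsetP => e; rewrite inE => /andP[].
- have cls_sub : cls \subset [set phi : {ffun {set V} -> 'I_l.+1} | sample F phi == set0].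
    apply/subsetP => phi /clsP[_ dis _ _]; rewrite inE -subset0.
    apply/subsetP => e; rewrite inE => /andP[eF phie0].
    have := disjointFl dis eF; rewrite inE phie0 andbT.
    by move: eF; rewrite inE => /andP[-> _].
  have := leq_trans cls_ge (leq_mul (leqnn _) (subset_leq_card cls_sub)).
  rewrite card_sample_set0 -(cardsC F) expnD -hE mulnA.
  rewrite leq_pmul2r ?expn_gt0 // ltnNge => F_le; apply/negP => /expn2_mul_le.
  have l_gt0 : 0 < l ^ #|F| by rewrite expn_gt0 /l; lia.
  have : 0 < 2 ^ S * l ^ #|F| by rewrite muln_gt0 expn_gt0.
  move: F_le; rewrite !(expnS 2) -!mulnA; move: (2 ^ S * _) (_ ^ _) => X Y; lia.
- by exists (sample M phi0); exact: clsP.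
- move=> e; rewrite !inE negb_and => /andP[+ eM]; rewrite eM /= negb_forall.
  case/existsP => phi; rewrite negb_imply negbK => /andP[phi_cls e_in].
  by exists (sample M phi); have [? ? ? ?] := clsP _ phi_cls.
Qed.
End Round.

(** * The adversary over several rounds *)

Section Adversary.
Variable V : finType.
Implicit Types (U W : {set V}) (M F G E : {set {set V}}) (s : seq {set V}).

Lemma sum_degree F : \sum_v degree F v = \sum_(e in F) #|e|.
Proof.
rewrite /degree; under eq_bigr do rewrite -sum1_card.
under [RHS]eq_bigr do rewrite -sum1_card.
rewrite (exchange_big_dep (fun e => e \in F)) /= => [|v e _]; last by rewrite inE => /andP[].
by apply: eq_bigr => e eF; apply: eq_bigl => v; rewrite inE eF.
Qed.

Lemma degreeS M F v : M \subset F -> degree M v <= degree F v.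
Proof.
move=> /subsetP sMF; apply/subset_leq_card/subsetP => e.
by rewrite !inE => /andP[/sMF-> ->].
Qed.

Lemma degreeU M F v : degree (M :|: F) v <= degree M v + degree F v.
Proof.
rewrite /degree; apply: leq_trans _ (leq_card_setU _ _).
by apply: subset_leq_card; apply/subsetP => e; rewrite !inE -andb_orl.
Qed.

Variables (A : stream_alg V) (k : nat).
Local Notation upd := (foldl (@update V A)).

(** The streams of edges outside [M], with degrees at most [d], that lead to
    [q]. Avoiding [M] is what allows such a stream to be continued by edges of
    [M] without repeating an edge. *)
Definition reaches M (d : nat) (q : state A) s : Prop :=
  [/\ uniq s, {in s, forall e : {set V}, #|e| = k}, {in s, forall e, e \notin M},
      (forall v, degree [set e in s] v <= d) & upd (init A) s = q].

Lemma reaches_cat M F G d d' q s :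
    {in M, forall e : {set V}, #|e| = k} -> G \subset M -> F \subset M -> [disjoint G & F] ->
    (forall v, degree G v <= d') -> reaches M d q s ->
  reaches F (d + d') (upd q (enum G)) (s ++ enum G).
Proof.
move=> Mk /subsetP sGM /subsetP sFM dGF degG [s_uniq sk sM degs <-]; split.
- rewrite cat_uniq s_uniq enum_uniq andbT -all_predC; apply/allP => e /=.
  by rewrite mem_enum => /sGM; apply: contraL => /sM.
- by move=> e; rewrite mem_cat mem_enum => /orP[/sk|/sGM/Mk].
- move=> e; rewrite mem_cat mem_enum => /orP[/sM|eG]; first by apply: contra => /sFM.
  by rewrite (disjointFr dGF eG).
- move=> v; have -> : [set e in s ++ enum G] = [set e in s] :|: G.
    by apply/setP => e; rewrite !inE mem_cat mem_enum.
  exact: leq_trans (degreeU _ _ _) (leq_add _ _).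
- by rewrite foldl_cat.
Qed.

(** The invariant of the adversary after [i] rounds. Each round is an
    application of [popular_state] to [M], followed by the deletion of the
    vertices whose degree in [F] exceeds half of the current degree bound; by
    the handshake lemma there are at most 4k(S+2)/m of them. A k-set that leaves
    the missing set in this round belongs to some sample leading to the new
    state, and one that had left it before keeps its old stream, continued by an
    arbitrary sample. *)
Lemma adversary (S m B t i : nat) :
    #|V| <= 2 ^ m -> #|state A| <= 2 ^ S -> 0 < B ->
    (forall v, degree [set e : {set V} | #|e| == k] v <= B * 2 ^ t * m) -> i <= t ->
  exists U M q,
    [/\ {in M, forall e : {set V}, #|e| = k /\ e \subset U},
        #|~: U| * m <= i * (4 * k * S.+2),
        forall v, degree M v <= B * 2 ^ (t - i) * m,
        exists s, reaches M (i * m.*2) q s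
      & forall e : {set V}, #|e| = k -> e \subset U -> e \notin M ->
          exists s, reaches M (i * m.*2) q s /\ e \in s].
Proof.
move=> V_le A_le B_gt0 deg0; elim: i => [_|i IHi lt_it].
  exists [set: V], [set e : {set V} | #|e| == k], (init A); split.
  - by move=> e; rewrite inE subsetT => /eqP.
  - by rewrite setCT cards0.
  - by rewrite subn0.
  - exists [::]; split=> // v; rewrite leqn0 cards_eq0 -subset0.
    by apply/subsetP => e; rewrite !inE.
  - by move=> e ek; rewrite inE ek eqxx.
have [U [M [q [MU Uc_le degM [s0 s0P] cover]]]] := IHi (ltnW lt_it).
have Mk : {in M, forall e : {set V}, #|e| = k} by move=> e /MU[].
pose h' := B * 2 ^ (t - i.+1); have h'_gt0 : 0 < h' by rewrite muln_gt0 B_gt0 expn_gt0.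
have hE : B * 2 ^ (t - i) = h'.*2 by rewrite -mul2n mulnCA -expnS -subSn // subSS.
have h_gt0 : 0 < h'.*2 by rewrite double_gt0.
rewrite hE in degM.
have [q' [F [sFM F_lt [G0 [sG0 dG0 degG0 fG0]] cover']]] :=
  popular_state (fun G => upd q (enum G)) h_gt0 V_le A_le degM.
pose W := [set v | h' * m < degree F v].
pose M' := [set e in F | [disjoint e & W]].
have sM'F : M' \subset F by apply/subsetP => e; rewrite inE => /andP[].
have sM'M := subset_trans sM'F sFM.
have dM' G : [disjoint G & F] -> [disjoint G & M'] by exact: disjointWr.
exists (U :\: W), M', q'; split.
- move=> e; rewrite inE => /andP[/(subsetP sFM)/MU[ek eU] eW]; split=> //.
  by rewrite subsetD eU.
- have W_le : #|W| * m <= 4 * k * S.+2.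
    rewrite -(leq_pmul2l h'_gt0) mulnCA.
    have : #|W| * (h' * m) <= \sum_v degree F v.
      rewrite -sum_nat_const big_mkcond /=; apply: leq_sum => v _.
      by rewrite inE; case: ifP => // /ltnW.
    move/leq_trans; apply; rewrite sum_degree.
    rewrite (eq_bigr (fun=> k)) => [|e /(subsetP sFM)/Mk //].
    by rewrite sum_nat_const; nia.
  rewrite setCD -[i.+1]addn1 mulnDl mul1n.
  apply: leq_trans (leq_add Uc_le W_le).
  by rewrite -mulnDl leq_mul2r leq_card_setU orbT.
- move=> v; have [vW|vW] := boolP (v \in W).
    rewrite (_ : degree M' v = 0) //; apply/eqP; rewrite cards_eq0 -subset0.
    apply/subsetP => e; rewrite !inE => /andP[/andP[_ dis] ve].
    by have := disjointFr dis ve; rewrite vW.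
  by apply: leq_trans (degreeS v sM'F) _; move: vW; rewrite inE -leqNgt.
- exists (s0 ++ enum G0); rewrite mulSn addnC -fG0.
  exact: reaches_cat (dM' _ dG0) degG0 s0P.
- move=> e ek; rewrite subsetD => /andP[eU eW] eM'.
  have [eM|eM] := boolP (e \in M); last first.
    have [s [sP es]] := cover e ek eU eM; exists (s ++ enum G0).
    rewrite mulSn addnC -fG0 mem_cat es; split=> //.
    exact: reaches_cat (dM' _ dG0) degG0 sP.
  have [|G [sG dG degG fG eG]] := cover' e.
    by rewrite inE eM andbT; apply: contra eM' => eF; rewrite inE eF.
  exists (s0 ++ enum G); rewrite mulSn addnC -fG mem_cat mem_enum eG orbT; split=> //.
  exact: reaches_cat (dM' _ dG) degG s0P.
Qed.

End Adversary.

(** * From missing sets to colors *)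

Lemma expn_le_ffact (p K : nat) : (p.+1 - K) ^ K <= p ^_ K.
Proof.
elim: K p => [|K IHK] [|p] //; first by rewrite subSS sub0n exp0n.
by rewrite ffactSS expnS subSS leq_mul ?leq_subr.
Qed.

Lemma bin_le_expn (p K : nat) : 'C(p, K) <= p ^ K.
Proof.
apply: leq_trans (leq_pmulr _ (fact_gt0 K)) _; rewrite bin_ffact.
elim: K p => [|K IHK] [|p] //; rewrite ffactSS expnS leq_mul //.
by apply: leq_trans (IHK p) _; rewrite leq_expn2r.
Qed.

Lemma card_star (V : finType) (X : {set V}) (v : V) (K : nat) : v \in X ->
  #|[set e : {set V} | (e \subset X) && (#|e| == K.+1) & v \in e]| = 'C(#|X|.-1, K).
Proof.
move=> vX; rewrite -[#|X|.-1](_ : #|X :\ v| = _); last by rewrite (cardsD1 v X) vX.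
rewrite -cards_draws.
have inj : {in [set e : {set V} | (e \subset X :\ v) & #|e| == K] &,
             injective (fun e : {set V} => v |: e)}.
  move=> e1 e2; rewrite !inE !subsetD1 => /andP[/andP[_ v1] _] /andP[/andP[_ v2] _] e12.
  by rewrite -(setU1K v1) e12 setU1K.
rewrite -(card_in_imset inj); apply: eq_card => e; apply/idP/imsetP => [|[e' + ->]].
  rewrite inE => /andP[/andP[eX eK] ve]; exists (e :\ v); last by rewrite setD1K.
  by move: eK; rewrite inE setSD // (cardsD1 v e) ve.
rewrite !inE !subsetD1 eqxx /= => /andP[/andP[e'X v'] /eqP e'K].
by rewrite subUset sub1set vX e'X cardsU1 v' e'K add1n eqxx.
Qed.

Section Colors.
Variables (n k : nat) (A : stream_alg 'I_n) (D : nat).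

Lemma stream_valid (M : {set {set 'I_n}}) d (q : state A) s :
  d <= D -> reaches k M d q s ->
  valid_input k D [set e in s] /\ s \in streams [set e in s].
Proof.
move=> le_dD [s_uniq sk _ degs _]; split.
  apply/andP; split; first by apply/forall_inP => e; rewrite inE => /sk->.
  by apply/bigmax_leqP => v _; apply: leq_trans (degs v) le_dD.
rewrite mem_permutations uniq_perm ?enum_uniq // => e.
by rewrite mem_enum inE.
Qed.

Lemma run_colors_le E s : valid_input k D E -> s \in streams E ->
  num_colors (run A s) <= worst_case_colors A k D.
Proof.
move=> vE sE; rewrite /worst_case_colors.
apply: leq_trans (leq_bigmax_cond _ vE).
by apply: (@leq_bigmax_seq _ _ xpredT (fun s => num_colors (run A s))).
Qed.
End Colors.

(** The starting bound [B] on the degrees is chosen so that [B * 2 ^ t] is just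
    above n^K. If fewer than [2 ^ r] colors were used, some color class [X] of
    surviving vertices would have at least n / 2^(r+1) elements, and the star of
    k-sets inside [X] at one of its vertices would exceed the final degree bound
    [B * m]. *)
Lemma colors_lower_bound (n K r m S D : nat) (A : stream_alg 'I_n) :
  0 < K ->
  let k := K.+1 in let t := k * r.+2 in
  2 * m * K`! < 2 ^ r.+2 -> 2 ^ t <= n -> n <= 2 ^ m ->
  8 * k * t * S.+2 <= m * n -> t * m.*2 <= D ->
  #|state A| <= 2 ^ S -> properly_colors A k D ->
  2 ^ r <= worst_case_colors A k D.
Proof.
move=> K_gt0 k t m_lt t_le n_le S_le D_ge A_le A_ok.
have n_gt1 : 1 < n by apply: leq_trans t_le; rewrite -{1}(expn0 2) ltn_exp2l.
have m_gt0 : 0 < m by case: (m) n_le => //; rewrite expn0; lia.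
(* The quotient is rounded up, which also keeps [B] positive. *)
pose B := (n ^ K %/ 2 ^ t).+1.
have B_ge : n ^ K <= B * 2 ^ t by rewrite ltnW // ltn_ceil // expn_gt0.
have B_le : B * 2 ^ t <= 2 * n ^ K.
  rewrite /B mulSn mul2n -addnn leq_add ?leq_divM // (leq_trans t_le) //.
  by rewrite -{1}(expn1 n) leq_exp2l.
have deg0 v : degree [set e : {set 'I_n} | #|e| == k] v <= B * 2 ^ t * m.
  apply: leq_trans (leq_pmulr _ m_gt0); apply: leq_trans B_ge.
  have -> : degree [set e : {set 'I_n} | #|e| == k] v = 'C(n.-1, K).
    rewrite -[n in n.-1]card_ord -cardsT -(card_star _ (in_setT v)).
    by apply: eq_card => e; rewrite !inE subsetT.
  by apply: leq_trans (bin_le_expn _ _) _; rewrite leq_expn2r ?leq_pred.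
have V_le : #|'I_n| <= 2 ^ m by rewrite card_ord.
have [U [M [q [MU Uc_le degM [s0 s0P] cover]]]] :=
  @adversary _ A k S m B t t V_le A_le (ltn0Sn _) deg0 (leqnn t).
rewrite subnn muln1 in degM.
pose f := output q.
have fE s : reaches k M (t * m.*2) q s -> run A s = f by rewrite /run => -[_ _ _ _ ->].
have [E0 s0E0] := stream_valid D_ge s0P.
apply: leq_trans (run_colors_le A E0 s0E0); rewrite (fE _ s0P) leqNgt; apply/negP => few.
have mono_missing (e : {set 'I_n}) : #|e| = k -> e \subset U -> monochromatic f e -> e \in M.
  move=> ek eU; apply: contraLR => /(cover e ek eU)[s [sP es]].
  have [vE sE] := stream_valid D_ge sP.
  have /forall_inP/(_ e) := A_ok _ _ vE sE.
  by rewrite inE (fE _ sP); apply.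
have U_ge : n <= 2 * #|U|.
  have := cardsC U; rewrite card_ord => nE.
  (* The deletions of all rounds together cost at most half of the vertices. *)
  have : 2 * #|~: U| <= n by rewrite -(leq_pmul2r m_gt0); nia.
  lia.
have U_neq0 : U != set0 by rewrite -card_gt0; lia.
have f_codom : {in U, forall x, f x \in undup (codom f)}.
  by move=> x _; rewrite mem_undup codom_f.
have [c _] := pigeonhole (undup_uniq _) f_codom U_neq0.
rewrite -/(num_colors f); set X := [set x in U | _] => X_ge.
have n_leX : n <= 2 ^ r.+1 * #|X|.
  rewrite expnS -mulnA; apply: leq_trans U_ge _; rewrite leq_mul2l /=.
  by apply: leq_trans X_ge _; rewrite leq_mul2r ltnW ?orbT.
(* This makes x - K at least x / 2, so the falling factorial is not degenerate. *)
have X_ge2K : 2 * K <= #|X|.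
  have p_gt0 : 0 < 2 ^ r.+1 by rewrite expn_gt0.
  rewrite -(leq_pmul2l p_gt0); apply: leq_trans n_leX; apply: leq_trans t_le.
  rewrite mulnA -expnSr /t /k mulSn expnD leq_mul2l; apply/orP; right.
  by apply: leq_trans (ltnW (ltn_expl K (isT : 1 < 2))) _; rewrite leq_exp2l // leq_pmulr.
have [v vX] : exists v, v \in X by apply/set0Pn; rewrite -card_gt0; lia.
have star_le : 'C(#|X|.-1, K) <= B * m.
  apply: leq_trans (degM v); rewrite -(card_star K vX) /degree.
  apply/subset_leq_card/subsetP => e; rewrite !inE => /andP[/andP[eX /eqP eK] ->].
  rewrite andbT; apply: mono_missing => //.
    by apply: subset_trans eX _; apply/subsetP => x; rewrite inE => /andP[].
  apply/forall_inP => x /(subsetP eX); rewrite inE => /andP[_ /eqP->].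
  by apply/forall_inP => y /(subsetP eX); rewrite inE => /andP[_ /eqP->].
set y := #|X| - K.
have y_gt0 : 0 < y ^ K by rewrite expn_gt0 /y; lia.
have n_ley : n ^ K <= 2 ^ (r.+2 * K) * y ^ K.
  rewrite expnM -expnMn leq_expn2r // (leq_trans n_leX) // (expnS 2 r.+1) (mulnC 2) -mulnA.
  by rewrite leq_mul2l /y; lia.
have y_le : y ^ K <= B * m * K`!.
  apply: leq_trans (leq_mul star_le (leqnn K`!)); rewrite bin_ffact.
  by apply: leq_trans (expn_le_ffact _ _); rewrite prednK // card_gt0; apply/set0Pn; exists v.
have : y ^ K * 2 ^ t <= 2 * m * K`! * (2 ^ (r.+2 * K) * y ^ K).
  apply: leq_trans (leq_mul y_le (leqnn _)) _; nia.
have -> : 2 ^ t = 2 ^ r.+2 * 2 ^ (r.+2 * K) by rewrite /t /k mulSn expnD (mulnC K).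
by rewrite (mulnC (y ^ K)) -mulnA leq_pmul2r ?muln_gt0 ?y_gt0 ?expn_gt0 // leqNgt m_lt.
Qed.

(** * Choice of the parameters *)

Local Open Scope ring_scope.

Section ParameterChoice.
Variable R : realType.
Implicit Types (a y z : R).

Lemma expR_le_pow2 z (r : nat) : 2 * z <= r%:R -> expR z <= (2 ^ r)%:R.
Proof.
move=> z_le; have half_le : expR (2^-1 : R) <= 2.
  have := @expR_ge1Dx R (- 2^-1); rewrite expRN => half_ge.
  have e_gt0 := @expR_gt0 R 2^-1.
  have : 2^-1 <= (expR (2^-1 : R))^-1 by lra.
  by rewrite lef_pV2 ?posrE.
rewrite natrX; apply: le_trans (_ : expR (2^-1 : R) ^+ r <= _).
  by rewrite -expRM_natr ler_expR; lra.
by rewrite lerXn2r // nnegrE ?expR_ge0.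
Qed.

Lemma pow2_le_expR (r : nat) z : r%:R <= z -> (2 ^ r)%:R <= expR z.
Proof.
move=> r_le; rewrite natrX; apply: le_trans (_ : expR (1 : R) ^+ r <= _).
  rewrite lerXn2r ?nnegrE ?expR_ge0 //.
  by have := @expR_ge1Dx R 1; lra.
by rewrite -expRM_natr ler_expR mul1r.
Qed.

Lemma Delta_bounds (C a : R) (n : nat) : 0 <= C ->
  C * ln n%:R `^ (a + 2) <= (Delta C a n)%:R <= C * ln n%:R `^ (a + 2) + 1.
Proof.
move=> C_ge0; have x_ge0 : 0 <= C * ln n%:R `^ (a + 2) by rewrite mulr_ge0 ?powR_ge0.
rewrite /Delta natr_absz ger0_norm; last by rewrite ceil_ge0 //; lra.
rewrite ceil_ge /= -lerBlDr ltW //.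
by have := ceilB1_lt (C * ln n%:R `^ (a + 2)); rewrite intrD.
Qed.

Lemma ln_eventually_ge (Y : R) : exists N : nat, forall n : nat, (N <= n)%N -> 0 < n%:R :> R /\ Y <= ln (n%:R : R).
Proof.
exists (Num.truncn (expR Y)).+1 => n le_n.
have n_gt : expR Y <= n%:R.
  by apply: le_trans (ltW (truncnS_gt _)) _; rewrite ler_nat.
have n_gt0 : 0 < n%:R :> R by apply: lt_le_trans n_gt; rewrite expR_gt0.
by split=> //; rewrite -ler_expR lnK ?posrE.
Qed.

Lemma powR4K (l : R) : 0 <= l -> (l `^ 4^-1) ^+ 4 = l.
Proof.
move=> l_ge0; rewrite -powR_mulrn ?powR_ge0 // -powRrM.
by rewrite mulVf ?powRr1 ?pnatr_eq0.
Qed.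

(** The exponent 1/(4(a+2)) turns [Delta] into the fourth root of the logarithm,
    up to the factor 2 that absorbs the rounding. *)
Lemma Delta_power a (n : nat) : 0 <= a -> 1 <= ln (n%:R : R) ->
  let c := (4 * (a + 2))^-1 in let y := ln (n%:R : R) `^ 4^-1 in
  let z := (Delta 1 a n)%:R `^ c in
  [/\ y <= z, z <= 2 * y & (Delta (1 : R) a n)%:R = z `^ (4 * (a + 2))].
Proof.
move=> a_ge0 l_ge1 c y z.
have l_ge0 : 0 <= ln (n%:R : R) by lra.
have c_gt0 : 0 < c by rewrite invr_gt0; lra.
have yE : y = (ln n%:R `^ (a + 2)) `^ c.
  rewrite -powRrM /c /y; congr (_ `^ _); rewrite invfM mulrCA mulfV ?mulr1 //.
  by apply: lt0r_neq0; lra.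
have := @Delta_bounds 1 a n ler01; rewrite mul1r => /andP[D_ge D_le].
have la_ge1 : 1 <= ln (n%:R : R) `^ (a + 2).
  by rewrite -[X in X <= _](powRr0 (ln (n%:R : R))) ler_powR //; lra.
have y_ge0 : 0 <= y by exact: powR_ge0.
split.
- by rewrite yE ge0_ler_powR ?nnegrE // ?powR_ge0 // ltW.
- have -> : 2 * y = (2 `^ (4 * (a + 2)) * ln n%:R `^ (a + 2)) `^ c.
    rewrite powRM ?powR_ge0 // -yE -powRrM mulfV ?powRr1 //.
    by apply: lt0r_neq0; lra.
  rewrite ge0_ler_powR ?nnegrE ?ler0n ?mulr_ge0 ?powR_ge0 ?(ltW c_gt0) //.
  have : 2 <= 2 `^ (4 * (a + 2)) :> R by rewrite le1r_powR //; lra.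
  move=> Q_ge; apply: le_trans D_le _; set X := _ `^ _ in la_ge1 *.
  by apply: le_trans (_ : 2 * X <= _); [lra | rewrite ler_wpM2r // /X powR_ge0].
- by rewrite /z -powRrM mulVf ?powRr1 //; apply: lt0r_neq0; lra.
Qed.

(** With y = log^(1/4) n, both [r] and [t] are of order y, while m ~ D/(2t) is at
    least of order y^7 log^a n. This dominates log n = y^4 and the term
    [t * log^a n] coming from the space bound; 2^t is below n since t = O(y), and
    2^r dominates m because exp(z) dominates every power of z. *)
Lemma parameters_exist (K : nat) (a C0 : R) : 0 <= a -> 0 < C0 ->
  exists N : nat, forall n : nat, (N <= n)%N -> exists r m : nat,
    let k := K.+1 in let t := (k * r.+2)%N in let D := Delta 1 a n in
    [/\ expR (D%:R `^ (4 * (a + 2))^-1) <= (2 ^ r)%:R :> R,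
        (2 * m * K`! < 2 ^ r.+2)%N, (2 ^ t <= n)%N, (n <= 2 ^ m)%N
      & (t * m.*2 <= D)%N /\ forall S : nat, S%:R <= C0 * n%:R * ln n%:R `^ a ->
          (8 * k * t * S.+2 <= m * n)%N].
Proof.
move=> a_ge0 C0_gt0; set k := K.+1.
pose p := (Num.truncn (4 * (a + 2))).+1.
have p_ge : 4 * (a + 2) <= p%:R by rewrite ltW // truncnS_gt.
pose kr : R := k%:R.
have kr_ge1 : 1 <= kr by rewrite ler1n.
(* The first summand lets exp(z) dominate m, the second gives [n <= 2 ^ m], the
   third absorbs the space bound. *)
pose Y0 : R := (2 * K`! * p.+1`!)%:R + 42 * kr + 14 * kr * (56 * kr ^+ 2 * (C0 + 2) + 1) + 1.
have [N NP] := ln_eventually_ge (Y0 ^+ 4).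
exists N => n /NP[n_gt0 l_ge].
set l := ln (n%:R : R) in l_ge *.
have Y1 : 0 <= (2 * K`! * p.+1`!)%:R :> R by [].
have Y3 : 0 <= 14 * kr * (56 * kr ^+ 2 * (C0 + 2) + 1) by rewrite !mulr_ge0 ?addr_ge0 ?mulr_ge0 ?exprn_ge0 //; lra.
have Y0_ge1 : 1 <= Y0 by rewrite /Y0; lra.
have l_ge1 : 1 <= l by apply: le_trans l_ge; rewrite exprn_ege1.
have l_ge0 : 0 <= l by lra.
have /= := Delta_power a_ge0 l_ge1; set D := Delta 1 a n; rewrite -/l.
set y := l `^ 4^-1; set c := (_ * _)^-1; set z := _ `^ c => -[y_le z_le DE].
have y4 : y ^+ 4 = l by exact: powR4K.
have Y0_le : Y0 <= y.
  by rewrite -(@ler_pXn2r _ 4) ?nnegrE ?powR_ge0 ?y4 //; lra.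
have y_fact : (2 * K`! * p.+1`!)%:R <= y by rewrite /Y0 in Y0_le; lra.
have y_kr : 42 * kr <= y by rewrite /Y0 in Y0_le; lra.
have y_space : 14 * kr * (56 * kr ^+ 2 * (C0 + 2) + 1) <= y by rewrite /Y0 in Y0_le; lra.
have y_ge1 : 1 <= y by lra.
have z_gt0 : 0 < z by lra.
clear Y1 Y3 Y0_le Y0_ge1 l_ge NP N; clear Y0.
pose P := l `^ a.
have P_ge1 : 1 <= P by rewrite -[X in X <= _](powRr0 l) ler_powR.
have D_ge : P * y ^+ 8 <= D%:R.
  have := @Delta_bounds 1 a n ler01; rewrite mul1r => /andP[+ _]; apply: le_trans.
  rewrite -/l powRD; last by apply/implyP => _; lra.
  by rewrite -/P powR_mulrn // -y4 -exprM.
have D_le : D%:R <= z ^+ p.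
  rewrite DE -powR_mulrn; last lra.
  by rewrite ler_powR //; lra.
have [r r_ge r_le] : exists2 r : nat, 2 * z <= r%:R & r%:R <= 2 * z + 1.
  exists (Num.truncn (2 * z)).+1; first by rewrite ltW // truncnS_gt.
  by rewrite -[X in X <= _]natr1 lerD2r truncn_le //; lra.
pose t := (k * r.+2)%N.
have t_gt0 : (0 < t)%N by [].
have t_le : t%:R <= 7 * kr * y.
  rewrite natrM -/kr -[r.+2]addn2 natrD -mulrA (mulrCA 7) ler_wpM2l //; lra.
pose m := (D %/ t.*2)%N.
have m_ge : P * y ^+ 7 <= 14 * kr * (m%:R + 1).
  have : D%:R <= (2 * t%:R) * (m%:R + 1) :> R.
    rewrite natr1 -natrM -natrM ler_nat mul2n mulnC ltnW // ltn_ceil //.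
  move=> Dm; rewrite -(@ler_pM2r _ y); last lra.
  rewrite -(mulrA P) -exprSr; apply: le_trans D_ge _; apply: le_trans Dm _.
  have m1_ge0 : 0 <= m%:R + 1 :> R by rewrite natr1.
  by have := ler_wpM2r m1_ge0 t_le; lra.
(* Used with E = 2 against log n = y^4 and with a constant depending on [C0]
   against the space bound. *)
have m_large E : 0 <= E -> 14 * kr * (E + 1) <= y -> E * (P * y ^+ 6) <= m%:R.
  move=> E_ge0 E_le; have X_ge1 : 1 <= P * y ^+ 6 by rewrite mulr_ege1 ?exprn_ege1.
  set X := P * _ in X_ge1 *.
  have kr14 : 0 < 14 * kr by lra.
  suff : (E + 1) * X <= m%:R + 1 by lra.
  rewrite -(ler_pM2l kr14) mulrA; apply: le_trans m_ge.
  by rewrite (exprSr y 6) (mulrA P) -/X (mulrC X) ler_wpM2r //; lra.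
have z_exp : expR z <= (2 ^ r)%:R by exact: expR_le_pow2.
exists r, m; split=> //.
- (* One more power of z than D <= z^p requires pays for the factorials. *)
  have zp_gt0 : 0 < z ^+ p by rewrite exprn_gt0.
  have fact_gt : 0 < p.+1`!%:R :> R by rewrite ltr0n fact_gt0.
  rewrite -(ltr_nat R); apply: lt_le_trans (_ : expR z <= _); last first.
    by apply: le_trans z_exp _; rewrite ler_nat leq_exp2l // ltnW.
  have := @expR_ge1Dxn R z p (ltW z_gt0).
  suff : (2 * m * K`!)%:R <= z ^+ p.+1 / p.+1`!%:R :> R by lra.
  rewrite ler_pdivlMr // -natrM exprSr.
  apply: le_trans (_ : z ^+ p * (2 * K`! * p.+1`!)%:R <= _); last first.
    by rewrite ler_pM2l //; exact: le_trans y_le.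
  apply: le_trans (_ : (D * (2 * K`! * p.+1`!))%:R <= _); last by rewrite natrM ler_wpM2r.
  rewrite ler_nat; have : (m <= D)%N by exact: leq_div.
  by rewrite (mulnC 2%N) !mulnA => mD; rewrite !leq_mul.
- rewrite -(ler_nat R) -[n%:R]lnK ?posrE //; apply: pow2_le_expR.
  rewrite -/l -y4; apply: le_trans t_le _; rewrite exprSr ler_wpM2r; try lra.
  have : 7 * kr <= y by lra.
  by move=> /le_trans; apply; rewrite ler_eXnr //; lra.
- rewrite -(ler_nat R) -[n%:R]lnK ?posrE //; apply: expR_le_pow2; rewrite -/l -y4.
  apply: le_trans (m_large 2 _ _); [|lra|lra].
  rewrite ler_wpM2l //; apply: le_trans (_ : y ^+ 6 <= _); first exact: ler_weXn2l.
  by rewrite ler_peMl // exprn_ge0 //; lra.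
- split; first by rewrite -doubleMr doubleMl mulnC leq_divM.
  move=> S S_le; rewrite -(ler_nat R) 3!natrM -/kr -[S.+2]addn2 natrD (natrM _ m).
  pose E : R := 56 * kr ^+ 2 * (C0 + 2).
  have E_ge0 : 0 <= E by rewrite /E !mulr_ge0 ?exprn_ge0 //; lra.
  have n_ge1 : 1 <= n%:R :> R by rewrite ler1n -(ltr_nat R).
  have S2_le : S%:R + 2 <= (C0 + 2) * n%:R * P.
    have : 1 <= n%:R * P by rewrite mulr_ege1.
    by move: S_le; rewrite -/l -/P; lra.
  apply: le_trans (_ : E * (P * y) * n%:R <= _).
    apply: le_trans (_ : 8 * kr * (7 * kr * y) * ((C0 + 2) * n%:R * P) <= _).
      by rewrite ler_pM ?addr_ge0 ?mulr_ge0 ?ler0n // ler_wpM2l // mulr_ge0.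
    by rewrite le_eqVlt; apply/orP; left; apply/eqP; rewrite /E; ring.
  rewrite ler_wpM2r //; apply: le_trans (m_large E E_ge0 _); last exact: y_space.
  by rewrite ler_wpM2l // ler_wpM2l ?ler_eXnr //; lra.
Qed.
End ParameterChoice.

Unset Implicit Arguments.

Theorem theorem3 (R : realType) (k : nat) (a : R) (hk : (2 <= k)%N) (ha : 0 <= a) :
  exists c C : R, 0 < c /\ 0 < C /\
    forall C0 : R, 0 < C0 ->
    exists N : nat, forall n : nat, (N <= n)%N ->
    forall (A : stream_alg 'I_n) (S : nat),
      S%:R <= C0 * n%:R * ln n%:R `^ a ->
      uses_bits A S ->
      properly_colors A k (Delta C a n) ->
      expR ((Delta C a n)%:R `^ c) <= (worst_case_colors A k (Delta C a n))%:R :> R.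
Proof.
case: k hk => [|K] // K_gt0.
exists (4 * (a + 2))^-1, 1; split; first by rewrite invr_gt0; lra.
split=> // C0 C0_gt0; have [N NP] := parameters_exist K ha C0_gt0.
exists N => n /NP[r [m [exp_le m_lt t_le n_le [D_ge S_le]]]] A S /S_le Sn A_le A_ok.
apply: le_trans exp_le _; rewrite ler_nat.
exact: colors_lower_bound m_lt t_le n_le Sn D_ge A_le A_ok.
Qed.
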